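(* Let $V_1,\dots,V_p$ and $W_1,\dots,W_p$ be $k$-vector spaces of dimensions $n_1+1,\dots,n_p+1$ and $m_1+1,\dots,m_p+1$ respectively, let $d_1,\dots,d_p$ be positive integers, and set $U_i=V_i\oplus W_i$ for every $1\leq i\leq p$. Let $$T_1\in \mathrm{Sym}^{d_1}V_1\otimes\dots\otimes \mathrm{Sym}^{d_p}V_p\subset \mathrm{Sym}^{d_1}U_1\otimes\dots\otimes \mathrm{Sym}^{d_p}U_p,$$ $$T_2\in \mathrm{Sym}^{d_1}W_1\otimes\dots\otimes \mathrm{Sym}^{d_p}W_p\subset \mathrm{Sym}^{d_1}U_1\otimes\dots\otimes \mathrm{Sym}^{d_p}U_p$$ be two mixed tensors. Suppose that for every $i\in\{1,\dots,p\}$ there exists a pair $(a_i,b_i)$ with $a_i+b_i=d_i$ such that the associated $(A,B)$-flattenings $\widetilde{T}_1:V_A^*\to V_B$ and $\widetilde{T}_2:W_A^*\to W_B$ satisfy $$\dim \widetilde{T}_1(V_A^* )=\mathrm{rk}(T_1),\qquad \dim\widetilde{T}_2(W_A^* )=\mathrm{rk}(T_2).$$ Then $\mathrm{rk}(T_1+T_2)=\mathrm{rk}(T_1)+\mathrm{rk}(T_2)$.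
   Context: $k$ is a field. $\mathrm{Sym}^dV\subset V^{\otimes d}$ denotes the space of symmetric tensors, and $v^d=v^{\otimes d}$. The rank $\mathrm{rk}(T)$ of a mixed tensor $T\in \mathrm{Sym}^{d_1}U_1\otimes\dots\otimes \mathrm{Sym}^{d_p}U_p$ is its rank with respect to the Segre-Veronese variety, i.e. the minimal number $r$ such that $T$ is a linear combination of $r$ tensors of the form $u_1^{d_1}\otimes\dots\otimes u_p^{d_p}$ with $u_i\in U_i$. Flattenings: given non-negative integers $a_i,b_i$ with $a_i+b_i=d_i$ for all $i$, put $V_A=\mathrm{Sym}^{a_1}V_1\otimes\dots\otimes\mathrm{Sym}^{a_p}V_p$ and $V_B=\mathrm{Sym}^{b_1}V_1\otimes\dots\otimes\mathrm{Sym}^{b_p}V_p$, and define $W_A, W_B$ in the same way from the $W_i$. The natural inclusions $\mathrm{Sym}^{d_i}V_i\hookrightarrow \mathrm{Sym}^{a_i}V_i\otimes\mathrm{Sym}^{b_i}V_i$ give an embedding $\mathrm{Sym}^{d_1}V_1\otimes\dots\otimes\mathrm{Sym}^{d_p}V_p\hookrightarrow V_A\otimes V_B$, so a tensor $T$ in the left-hand side is interpreted as a linear map $\widetilde{T}:V_A^*\to V_B$, called its $(A,B)$-flattening. The same applies with the $W_i$ in place of the $V_i$.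
   Formalization: The formal theorem adds the assumption d_1+...+d_p ≥ 2, excluding only p=1, d_1=1 (and p=0), where the claim fails: for nonzero v in V_1, w in W_1 with (a_1,b_1)=(1,0), both flattenings have rank 1, but rk(v+w)=1, not 2. *)

(* Defs.v *)
From HB Require Import structures.
From mathcomp Require Import all_boot all_order all_fingroup all_algebra.

Set Implicit Arguments.
Unset Strict Implicit.
Unset Printing Implicit Defensive.

Import GRing.Theory.
Local Open Scope ring_scope.

Definition dual (k : fieldType) (V : vectType k) : vectType k := 'Hom(V, k^o).

Definition bas (k : fieldType) (V : vectType k) (i : 'I_(\dim {:V})) : V :=
  (vbasis {:V})`_i.

Definition crd (k : fieldType) (V : vectType k) (i : 'I_(\dim {:V})) (v : V) : k :=
  coord (vbasis {:V}) i v.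

(* The tensor product of the V j, given by coordinates in the product basis
   indexed by families f with f j < \dim (V j); tlift_pure is its universal
   property. *)
Definition tens (k : fieldType) (J : finType) (V : J -> vectType k) : vectType k :=
  {ffun {dffun forall j, 'I_(\dim {:V j})} -> k^o}.

Section Tensors.
Variables (k : fieldType) (J : finType).
Implicit Types (V W : J -> vectType k) (X : vectType k).

Definition pure V (v : forall j, V j) : tens V :=
  [ffun f : {dffun forall j, 'I_(\dim {:V j})} => \prod_j crd (f j) (v j)].

Definition multilinear V X (M : (forall j, V j) -> X) : Prop :=
  (forall v w, (forall j, v j = w j) -> M v = M w) /\
  (forall v j, linear (fun x : V j => M (dfwith v x))).

(* Only meaningful for multilinear M, see tlift_pure. *)
Definition tlift V X (M : (forall j, V j) -> X) : 'Hom(tens V, X) :=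
  linfun (fun t : tens V =>
    \sum_(f : {dffun forall j, 'I_(\dim {:V j})}) t f *: M (fun j => bas (f j))).

Definition tens_map V W (h : forall j, 'Hom(V j, W j)) : 'Hom(tens V, tens W) :=
  tlift (fun v => pure (fun j => h j (v j))).

End Tensors.

(* Binary tensor products, by coordinates in the product basis. *)
Definition tens2 (k : fieldType) (A B : vectType k) : vectType k :=
  'M[k]_(\dim {:A}, \dim {:B}).

Section BinaryTensors.
Variable k : fieldType.
Implicit Types A B X : vectType k.

Definition pure2 A B (a : A) (b : B) : tens2 A B :=
  \matrix_(i, j) (crd i a * crd j b).

Definition tlift2 A B X (M : A -> B -> X) : 'Hom(tens2 A B, X) :=
  linfun (fun t : tens2 A B => \sum_i \sum_j t i j *: M (bas i) (bas j)).

Definition tens2_map A B A' B' (g : 'Hom(A, A')) (h : 'Hom(B, B')) :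
    'Hom(tens2 A B, tens2 A' B') :=
  tlift2 (fun a b => pure2 (g a) (h b)).

(* a (x) b is sent to phi |-> phi(a) b, see contract_pure. *)
Definition contract A B : 'Hom(tens2 A B, 'Hom(dual A, B)) :=
  tlift2 (fun a b => linfun (fun phi : dual A => (phi a : k) *: b)).

(* (x)_j (A_j (x) B_j) -> ((x)_j A_j) (x) ((x)_j B_j), see regroup_pure. *)
Definition regroup (J : finType) (A B : J -> vectType k) :
    'Hom(tens (fun j => tens2 (A j) (B j)), tens2 (tens A) (tens B)) :=
  tlift (fun m : forall j, tens2 (A j) (B j) =>
    \sum_(f : {dffun forall j, 'I_(\dim {:A j})})
    \sum_(g : {dffun forall j, 'I_(\dim {:B j})})
      (\prod_j m j (f j) (g j)) *:
        pure2 (pure (fun j => bas (f j))) (pure (fun j => bas (g j)))).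

End BinaryTensors.

Section Symmetric.
Variable k : fieldType.
Implicit Types V U : vectType k.

(* V^{(x) d} *)
Definition tpow (d : nat) V : vectType k := tens (fun _ : 'I_d => V).

Definition tpow_perm d V (s : 'S_d) : 'Hom(tpow d V, tpow d V) :=
  tlift (fun v : 'I_d -> V => pure (fun i => v (s i))).

Definition symv (d : nat) V : {vspace tpow d V} :=
  (\bigcap_(s : 'S_d) fixedSpace (tpow_perm V s))%VS.

Definition symt (d : nat) V : vectType k := subvs_of (symv d V).

(* v^d as an element of Sym^d V; vsproj is only a coercion here, since v^{(x) d}
   is symmetric: see vsval_vpow. *)
Definition vpow (d : nat) V (v : V) : symt d V :=
  vsproj (symv d V) (pure (fun _ : 'I_d => v)).

(* Sym^d V -> Sym^d U induced by V -> U, see vsval_sym_map. *)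
Definition sym_map (d : nat) V U (h : 'Hom(V, U)) : 'Hom(symt d V, symt d U) :=
  linfun (fun t : symt d V =>
    vsproj (symv d U) (tens_map (fun _ : 'I_d => h) (vsval t))).

(* The identification of V^{(x) d} with V^{(x) a} (x) V^{(x) b}, see cut_pure. *)
Definition cut (a b d : nat) (h : (a + b)%N = d) V :
    'Hom(tpow d V, tens2 (tpow a V) (tpow b V)) :=
  tlift (fun v : 'I_d -> V =>
    pure2 (pure (fun i : 'I_a => v (cast_ord h (lshift b i))))
          (pure (fun i : 'I_b => v (cast_ord h (rshift a i))))).

Definition sym2_incl (a b : nat) V :
    'Hom(tens2 (symt a V) (symt b V), tens2 (tpow a V) (tpow b V)) :=
  tens2_map (linfun (@vsval _ _ (symv a V))) (linfun (@vsval _ _ (symv b V))).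

(* The natural inclusion Sym^d V -> Sym^a V (x) Sym^b V: the image of t is the
   unique preimage of cut t under the injection sym2_incl, see sym_splitP. *)
Definition sym_split (a b d : nat) (h : (a + b)%N = d) V :
    'Hom(symt d V, tens2 (symt a V) (symt b V)) :=
  linfun (fun t : symt d V => (sym2_incl a b V)^-1%VF (cut h V (vsval t))).

End Symmetric.

Section Mixed.
Variables (k : fieldType) (p : nat).
Implicit Types (d a b : 'I_p -> nat) (V W : 'I_p -> vectType k).

Definition mixed d V : vectType k := tens (fun i => symt (d i) (V i)).

Definition veronese d V (u : forall i, V i) : mixed d V :=
  pure (fun i => vpow (d i) (u i)).

Definition rank_le d V (T : mixed d V) (r : nat) : Prop :=
  exists (c : 'I_r -> k) (u : 'I_r -> forall i, V i),
    T = \sum_(l < r) c l *: veronese d (u l).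

(* rk(T) = r. A relation, because over a finite field a mixed tensor need not be
   a linear combination of tensors u_1^{d_1} (x) ... (x) u_p^{d_p}. *)
Definition has_rank d V (T : mixed d V) (r : nat) : Prop :=
  rank_le T r /\ (forall s, rank_le T s -> (r <= s)%N).

Definition mixed_map d V W (h : forall i, 'Hom(V i, W i)) :
    'Hom(mixed d V, mixed d W) :=
  tens_map (fun i => sym_map (d i) (h i)).

(* The (A,B)-flattening V_A^* -> V_B, with V_A = mixed a V and V_B = mixed b V. *)
Definition flattening a b d (h : forall i, (a i + b i)%N = d i) V (T : mixed d V) :
    'Hom(dual (mixed a V), mixed b V) :=
  contract (mixed a V) (mixed b V)
    (regroup (fun i => symt (a i) (V i)) (fun i => symt (b i) (V i))
      (tens_map (fun i => sym_split (h i) (V i)) T)).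

End Mixed.

Definition dsum (k : fieldType) (V W : vectType k) : vectType k := (V * W)%type.

Definition dinl (k : fieldType) (V W : vectType k) : 'Hom(V, dsum V W) :=
  linfun (fun v : V => (v, 0) : dsum V W).

Definition dinr (k : fieldType) (V W : vectType k) : 'Hom(W, dsum V W) :=
  linfun (fun w : W => (0, w) : dsum V W).


Lemma crd_bas (k : fieldType) (V : vectType k) (i j : 'I_(\dim {:V})) :
  crd i (bas j) = (i == j)%:R.
Proof. by rewrite /crd /bas coord_free ?(basis_free (vbasisP _)) // eq_sym. Qed.

Lemma crd_linear (k : fieldType) (V : vectType k) (i : 'I_(\dim {:V})) :
  linear (crd i : V -> k^o).
Proof. by move=> c u v; rewrite /crd linearP. Qed.

Lemma crd_sum (k : fieldType) (V : vectType k) (v : V) :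
  v = \sum_i crd i v *: bas i.
Proof. by rewrite {1}(coord_vbasis (memvf v)). Qed.

Lemma linfun_linear (k : fieldType) (A B : vectType k) (F : A -> B) :
  linear F -> linfun F =1 F.
Proof.
move=> Fl x; pose L : {linear A -> B} :=
  HB.pack F (GRing.isLinear.Build k A B *:%R F Fl).
by rewrite -[LHS]/(linfun L x) lfunE.
Qed.

Lemma linear_combination (k : fieldType) (A B : vectType k) (F : A -> B) (I : finType)
    (c : I -> k) (x : I -> A) :
  linear F -> F (\sum_i c i *: x i) = \sum_i c i *: F (x i).
Proof.
move=> Fl; rewrite -(linfun_linear Fl) linear_sum; apply: eq_bigr => i _.
by rewrite linearZ /= (linfun_linear Fl).
Qed.

Section Tensors.
Variables (k : fieldType) (J : finType).
Implicit Types (V W : J -> vectType k) (X : vectType k).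

Lemma tliftE V X (M : (forall j, V j) -> X) (t : tens V) :
  tlift M t = \sum_(f : {dffun forall j, 'I_(\dim {:V j})})
               t f *: M (fun j => bas (f j)).
Proof.
pose F (t : tens V) := \sum_(f : {dffun forall j, 'I_(\dim {:V j})})
               t f *: M (fun j => bas (f j)).
have F_lin : linear F.
  move=> c u v; rewrite /F scaler_sumr -big_split /=; apply: eq_bigr => f _.
  by rewrite !ffunE scalerA -scalerDl.
exact: (linfun_linear F_lin).
Qed.

Lemma pure_multilinear V : multilinear (@pure k J V).
Proof.
split=> [v w vw|v j c x y].
  by apply/ffunP => f; rewrite !ffunE; apply: eq_bigr => j _; rewrite vw.
apply/ffunP => f; rewrite !ffunE !(bigD1 (P := xpredT) j) //= !dfwith_in.
rewrite crd_linear /= mulrDl -mulrA; congr (_ * (_ * _) + _ * _);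
  by apply: eq_bigr => i ij; rewrite !dfwith_out // eq_sym.
Qed.

Lemma pure_bas V (f : {dffun forall j, 'I_(\dim {:V j})}) :
  pure (fun j => bas (f j)) = [ffun g => (g == f)%:R] :> tens V.
Proof.
apply/ffunP => g; rewrite !ffunE.
have [->|/eqP gf] := eqVneq g f.
  by rewrite big1 // => j _; rewrite crd_bas eqxx.
have [j gfj] : exists j, g j != f j.
  apply/existsP; rewrite -negb_forall; apply/negP => /forallP e; apply: gf.
  by apply/ffunP => j; apply/eqP.
by rewrite (bigD1 j) //= crd_bas (negPf gfj) mul0r.
Qed.

Lemma multilinear_ext V X (M N : (forall j, V j) -> X) :
  multilinear M -> multilinear N ->
  (forall f : {dffun forall j, 'I_(\dim {:V j})},
      M (fun j => bas (f j)) = N (fun j => bas (f j))) ->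
  forall v, M v = N v.
Proof.
move=> [Me Ml] [Ne Nl] MN v.
pose isb j := [exists i : 'I_(\dim {:V j}), v j == bas i].
have [n] := ubnP #|[pred j | ~~ isb j]|.
rewrite {}/isb; elim: n v => // n IH v.
case: (pickP [pred j | ~~ [exists i : 'I_(\dim {:V j}), v j == bas i]]) => [j nj|vb] lt.
  have step P : multilinear P ->
      P v = \sum_(i : 'I_(\dim {:V j})) crd i (v j) *: P (dfwith v (bas i)).
    move=> [Pe Pl].
    rewrite (Pe v (dfwith v (v j))); last by move=> i; case: dfwithP.
    by rewrite {1}[v j]crd_sum (linear_combination _ _ (Pl v j)).
  rewrite !step //; apply: eq_bigr => i _; congr (_ *: _); apply: IH.
  rewrite ltnS in lt; apply: leq_trans lt; apply: proper_card.
  apply/properP; split.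
    apply/subsetP => l; rewrite !inE; case: (eqVneq j l) => [<- _|jl] //.
    by rewrite dfwith_out.
  exists j => //; rewrite !inE dfwith_in negbK; apply/existsP; by exists i.
have fv j : {i : 'I_(\dim {:V j}) | v j == bas i}.
  by apply: sigW; apply/existsP; move: (vb j) => /= /negbFE.
pose f : {dffun forall j, 'I_(\dim {:V j})} := [ffun j => sval (fv j)].
have vf j : v j = bas (f j) by rewrite ffunE; apply/eqP/(svalP (fv j)).
by rewrite (Me _ _ vf) (Ne _ _ vf).
Qed.

Lemma tlift_pure V X (M : (forall j, V j) -> X) (v : forall j, V j) :
  multilinear M -> tlift M (pure v) = M v.
Proof.
move=> MM; have [pe pl] := pure_multilinear V.
apply: (@multilinear_ext _ _ (fun v => tlift M (pure v)) M) => //.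
  by split=> [u w /pe ->//|u j c x y]; rewrite pl linearP.
move=> f; rewrite pure_bas tliftE (bigD1 f) //= ffunE eqxx scale1r big1 ?addr0 // => g gf.
by rewrite ffunE (negPf gf) scale0r.
Qed.

Lemma tens_basis V (t : tens V) :
  t = \sum_(f : {dffun forall j, 'I_(\dim {:V j})}) t f *: pure (fun j => bas (f j)).
Proof.
apply/ffunP => g; rewrite sum_ffunE (bigD1 g) //= pure_bas !ffunE eqxx.
rewrite [_ *: _]mulr1 big1 ?addr0 // => f fg.
by rewrite pure_bas !ffunE eq_sym (negPf fg) scaler0.
Qed.

Lemma tens_map_pure V W (h : forall j, 'Hom(V j, W j)) (v : forall j, V j) :
  tens_map h (pure v) = pure (fun j => h j (v j)).
Proof.
apply: (tlift_pure (M := fun v => pure (fun j => h j (v j)))).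
have [pe pl] := pure_multilinear W.
split=> [u w uw|u j c x y]; first by apply: pe => j; rewrite uw.
have E z : pure (fun i => h i (dfwith u z i)) = pure (dfwith (fun i => h i (u i)) (h j z)).
  by apply: pe => i; case: dfwithP => [|i' ji]; rewrite ?dfwith_in // dfwith_out.
by rewrite !E linearP pl.
Qed.
End Tensors.

Section BinaryTensors.
Variable k : fieldType.
Implicit Types A B X : vectType k.

Lemma tlift2E A B X (M : A -> B -> X) (t : tens2 A B) :
  tlift2 M t = \sum_i \sum_j t i j *: M (bas i) (bas j).
Proof.
pose F (t : tens2 A B) := \sum_i \sum_j t i j *: M (bas i) (bas j).
have F_lin : linear F.
  move=> c u v; rewrite /F scaler_sumr -big_split /=; apply: eq_bigr => i _.
  rewrite scaler_sumr -big_split /=; apply: eq_bigr => j _.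
  by rewrite !mxE scalerA -scalerDl.
exact: (linfun_linear F_lin).
Qed.

Lemma pure2_linearl A B (b : B) : linear (fun a : A => pure2 a b).
Proof. by move=> c x y; apply/matrixP => i j; rewrite !mxE crd_linear mulrDl -mulrA. Qed.

Lemma pure2_linearr A B (a : A) : linear (fun b : B => pure2 a b).
Proof. by move=> c x y; apply/matrixP => i j; rewrite !mxE crd_linear mulrDr mulrCA. Qed.

Lemma tlift2_pure A B X (M : A -> B -> X) a b :
  (forall b, linear (M^~ b)) -> (forall a, linear (M a)) ->
  tlift2 M (pure2 a b) = M a b.
Proof.
move=> Ml Mr; rewrite tlift2E.
rewrite {2}[a]crd_sum (linear_combination _ _ (Ml b)); apply: eq_bigr => i _.
rewrite {2}[b]crd_sum (linear_combination _ _ (Mr _)) scaler_sumr.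
by apply: eq_bigr => j _; rewrite mxE scalerA.
Qed.

Lemma tens2_map_pure A B A' B' (g : 'Hom(A, A')) (h : 'Hom(B, B')) a b :
  tens2_map g h (pure2 a b) = pure2 (g a) (h b).
Proof.
apply: (tlift2_pure (M := fun a b => pure2 (g a) (h b))) => [b'|a'] c x y.
  by rewrite linearP pure2_linearl.
by rewrite linearP pure2_linearr.
Qed.

Lemma tens2_basis A B (t : tens2 A B) :
  t = \sum_i \sum_j t i j *: pure2 (bas i) (bas j).
Proof.
apply/matrixP => i j; rewrite summxE (bigD1 i) //= summxE (bigD1 j) //= !mxE.
rewrite !crd_bas !eqxx !mulr1 big1 => [|l lj]; last first.
  by rewrite !mxE !crd_bas eqxx [j == l]eq_sym (negPf lj) mulr0 mulr0.
rewrite addr0 big1 ?addr0 // => l li.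
rewrite summxE big1 // => l' _; by rewrite !mxE !crd_bas [i == l]eq_sym (negPf li) mul0r mulr0.
Qed.

Lemma contract_pure A B (a : A) (b : B) (phi : dual A) :
  contract A B (pure2 a b) phi = (phi a : k) *: b.
Proof.
pose F a (b : B) (phi : dual A) := (phi a : k) *: b.
have Fl a' b' : linear (F a' b').
  by move=> c f g; rewrite /F !lfunE /= !lfunE /= scalerDl -scalerA.
have FE a' b' : linfun (F a' b') =1 F a' b' by exact: linfun_linear.
rewrite /contract (tlift2_pure (M := fun a b => linfun (F a b))) ?FE //.
  move=> b' c x y; apply/lfunP => f.
  by rewrite FE !lfunE /= !lfunE /= !FE /F linearP scalerDl -scalerA.
move=> a' c x y; apply/lfunP => f.
by rewrite FE !lfunE /= !lfunE /= !FE /F scalerDr !scalerA mulrC.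
Qed.

Lemma regroup_pure (J : finType) (A B : J -> vectType k)
    (a : forall j, A j) (b : forall j, B j) :
  regroup A B (pure (fun j => pure2 (a j) (b j))) = pure2 (pure a) (pure b).
Proof.
rewrite /regroup tlift_pure.
  apply/matrixP => i j.
  rewrite [X in pure2 X _]tens_basis [X in pure2 _ X]tens_basis.
  rewrite (linear_combination _ _ (pure2_linearl _)).
  congr (fun_of_matrix _ i j); apply: eq_bigr => f _.
  rewrite (linear_combination _ _ (pure2_linearr _)) scaler_sumr.
  apply: eq_bigr => g _; rewrite scalerA !ffunE -big_split /=.
  by congr (_ *: _); apply: eq_bigr => l _; rewrite mxE.
split=> [v w vw|v j c x y].
  by apply: eq_bigr => f _; apply: eq_bigr => g _; congr (_ *: _); apply: eq_bigr => l _; rewrite vw.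
rewrite scaler_sumr -big_split; apply: eq_bigr => f _.
rewrite scaler_sumr -big_split; apply: eq_bigr => g _ /=.
rewrite scalerA -scalerDl; congr (_ *: _).
rewrite !(bigD1 (P := xpredT) j) //= !dfwith_in !mxE mulrDl mulrA.
by congr (_ * _ + _ * _); apply: eq_bigr => i ij; rewrite !dfwith_out // eq_sym.
Qed.
End BinaryTensors.


Lemma tens_ext (k : fieldType) (J : finType) (V : J -> vectType k) (X : vectType k)
    (g h : 'Hom(tens V, X)) :
  (forall v : forall j, V j, g (pure v) = h (pure v)) -> g =1 h.
Proof.
move=> gh t; rewrite [t]tens_basis !linear_sum.
by apply: eq_bigr => f _; rewrite !linearZ /= gh.
Qed.

Lemma tens2_ext (k : fieldType) (A B X : vectType k) (g h : 'Hom(tens2 A B, X)) :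
  (forall a b, g (pure2 a b) = h (pure2 a b)) -> g =1 h.
Proof.
move=> gh t; rewrite [t]tens2_basis !linear_sum.
apply: eq_bigr => i _; rewrite !linear_sum.
by apply: eq_bigr => j _; rewrite !linearZ /= gh.
Qed.

Section Reindex.
Variables (k : fieldType) (V : vectType k).

Lemma multilinear_reindex (I J : finType) (s : I -> J) : injective s ->
  forall (v : J -> V) (j : J) (c : k) (x y : V),
    pure (fun i : I => dfwith (T := fun _ => V) v (i := j) (c *: x + y) (s i)) =
      (if [exists i, s i == j] then c else 1) *:
        (pure (fun i => dfwith (T := fun _ => V) v (i := j) x (s i)) : tens (fun _ : I => V)) +
      (if [exists i, s i == j] then 1 else 0) *: pure (fun i => dfwith (T := fun _ => V) v (i := j) y (s i)).
Proof.
move=> sI v j c x y; have [pe pl] := pure_multilinear (fun _ : I => V).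
case: existsP => [[i /eqP<-]|nj]; last first.
  rewrite scale1r scale0r addr0; apply: pe => i.
  by rewrite !dfwith_out //; apply/eqP => e; case: nj; exists i; rewrite e.
have E z : pure (fun i' => dfwith (T := fun _ => V) v (i := s i) z (s i'))
           = pure (dfwith (T := fun _ => V) (fun i => v (s i)) (i := i) z) :> tens (fun _ : I => V).
  apply: pe => i'; case: (eqVneq i i') => [<-|ii']; first by rewrite !dfwith_in.
  by rewrite !dfwith_out // (inj_eq sI).
by rewrite !E pl scale1r.
Qed.

Lemma tpow_perm_pure d (s : 'S_d) (v : 'I_d -> V) :
  tpow_perm V s (pure v) = pure (fun i => v (s i)).
Proof.
rewrite /tpow_perm; apply: (tlift_pure (M := fun v : 'I_d -> V => pure (fun i => v (s i)))).
split=> [u w uw|u j c x y]; first by apply: (pure_multilinear _).1 => i; rewrite uw.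
rewrite (multilinear_reindex (@perm_inj _ s)).
have -> : [exists i, s i == j] by apply/existsP; exists (s^-1%g j); rewrite permKV.
by rewrite scale1r.
Qed.

Lemma cut_pure a b d (h : (a + b)%N = d) (v : 'I_d -> V) :
  cut h V (pure v) =
    pure2 (pure (fun i : 'I_a => v (cast_ord h (lshift b i))))
          (pure (fun i : 'I_b => v (cast_ord h (rshift a i)))).
Proof.
case: d / h v => v; rewrite /cut.
apply: (tlift_pure (M := fun v : 'I_(a + b) -> V => pure2
  (pure (fun i : 'I_a => v (cast_ord erefl (lshift b i))))
  (pure (fun i : 'I_b => v (cast_ord erefl (rshift a i)))))).
have li : injective (fun i : 'I_a => cast_ord (erefl (a + b)%N) (lshift b i)).
  by move=> i i' /cast_ord_inj /lshift_inj.
have ri : injective (fun i : 'I_b => cast_ord (erefl (a + b)%N) (rshift a i)).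
  by move=> i i' /cast_ord_inj /rshift_inj.
split=> [u w uw|u j c x y].
  by congr pure2; apply: (pure_multilinear _).1 => i; rewrite uw.
rewrite (multilinear_reindex li) (multilinear_reindex ri).
case: (splitP j) => [l jl|r jr].
  have ej : j = lshift b l by apply: val_inj.
  have -> : [exists i, cast_ord (erefl (a + b)%N) (lshift b i) == j].
    by apply/existsP; exists l; rewrite cast_ord_id ej.
  have nr i : (cast_ord (erefl (a + b)%N) (rshift a i) == j) = false.
    by rewrite cast_ord_id ej eq_sym eq_lrshift.
  have -> : [exists i, cast_ord (erefl (a + b)%N) (rshift a i) == j] = false.
    by apply/existsP => -[i]; rewrite nr.
  rewrite !scale1r scale0r addr0 pure2_linearl; congr (_ + pure2 _ _).
  apply: (pure_multilinear _).1 => i.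
  by rewrite !dfwith_out // eq_sym nr.
have ej : j = rshift a r by apply: val_inj.
have -> : [exists i, cast_ord (erefl (a + b)%N) (rshift a i) == j].
  by apply/existsP; exists r; rewrite cast_ord_id ej.
have nr i : (cast_ord (erefl (a + b)%N) (lshift b i) == j) = false.
  by rewrite cast_ord_id ej eq_lrshift.
have -> : [exists i, cast_ord (erefl (a + b)%N) (lshift b i) == j] = false.
  by apply/existsP => -[i]; rewrite nr.
rewrite !scale1r scale0r addr0 pure2_linearr; congr (_ + pure2 _ _).
apply: (pure_multilinear _).1 => i.
by rewrite !dfwith_out // eq_sym nr.
Qed.

Lemma symvP d (t : tpow d V) :
  reflect (forall s : 'S_d, tpow_perm V s t = t) (t \in symv d V).
Proof.
apply: (iffP idP) => [ts s|ts].
  by apply/fixedSpaceP; apply: subvP ts; rewrite /symv (bigcapv_inf s).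
rewrite memvE; apply/subv_bigcapP => s _; rewrite -memvE; exact/fixedSpaceP.
Qed.

Lemma vsval_vpow d (v : V) : vsval (vpow d v) = pure (fun _ : 'I_d => v).
Proof. by rewrite vsprojK //; apply/symvP => s; rewrite tpow_perm_pure. Qed.
End Reindex.

Lemma vsval_sym_map (k : fieldType) d (V U : vectType k) (h : 'Hom(V, U)) (t : symt d V) :
  vsval (sym_map d h t) = tens_map (fun _ => h) (vsval t).
Proof.
rewrite /sym_map linfun_linear => [|c x y]; last by rewrite !linearP.
rewrite vsprojK //; apply/symvP => s.
rewrite -[X in _ = tens_map _ X](symvP _ (subvsP t) s) -!comp_lfunE.
apply: tens_ext => v; rewrite !comp_lfunE.
by rewrite tens_map_pure !tpow_perm_pure tens_map_pure.
Qed.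

Section Split.
Variables (k : fieldType) (V : vectType k).

Lemma lker_sym2_incl a b : lker (sym2_incl a b V) == 0%VS.
Proof.
have lv n : linear (@vsval _ _ (symv n V)) by move=> c x y; rewrite linearP.
have lp n : linear (vsproj (symv n V)) by move=> c x y; rewrite linearP.
apply/lker0P; apply: (can_inj (g := tens2_map (linfun (vsproj (symv a V)))
                                     (linfun (vsproj (symv b V))))) => t.
rewrite -comp_lfunE -[RHS]id_lfunE; apply: tens2_ext => x y.
rewrite comp_lfunE /sym2_incl !tens2_map_pure id_lfunE.
by rewrite (linfun_linear (lv a)) (linfun_linear (lp a)) (linfun_linear (lv b)) (linfun_linear (lp b)) !vsvalK.
Qed.

Lemma pure2_coordr (A B : vectType k) (t : tens2 A B) :
  t = \sum_j pure2 (\sum_i t i j *: bas i) (bas j).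
Proof.
rewrite {1}[t]tens2_basis exchange_big; apply: eq_bigr => j _.
by rewrite (linear_combination _ _ (pure2_linearl _)).
Qed.

Lemma pure2_coordl (A B : vectType k) (t : tens2 A B) :
  t = \sum_i pure2 (bas i) (\sum_j t i j *: bas j).
Proof.
rewrite {1}[t]tens2_basis; apply: eq_bigr => i _.
by rewrite (linear_combination _ _ (pure2_linearr _)).
Qed.

Lemma tens2_map_coordr (A B A' B' : vectType k) (g : 'Hom(A, A')) (h : 'Hom(B, B'))
    (t : tens2 A B) :
  tens2_map g h t = \sum_j pure2 (g (\sum_i t i j *: bas i)) (h (bas j)).
Proof.
rewrite {1}[t]pure2_coordr linear_sum; apply: eq_bigr => j _; exact: tens2_map_pure.
Qed.

Lemma tens2_map_coordl (A B A' B' : vectType k) (g : 'Hom(A, A')) (h : 'Hom(B, B'))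
    (t : tens2 A B) :
  tens2_map g h t = \sum_i pure2 (g (bas i)) (h (\sum_j t i j *: bas j)).
Proof.
rewrite {1}[t]pure2_coordl linear_sum; apply: eq_bigr => j _; exact: tens2_map_pure.
Qed.

Lemma pure2_sum_bas_r (A B : vectType k) (x y : 'I_(\dim {:B}) -> A) :
  \sum_j pure2 (x j) (bas j) = \sum_j pure2 (y j) (bas j) -> x =1 y.
Proof.
move=> e j; rewrite [x j]crd_sum [y j]crd_sum; apply: eq_bigr => i _.
have E z : (\sum_j pure2 (z j) (bas j : B)) i j = crd i (z j : A).
  rewrite summxE (bigD1 j) //= mxE crd_bas eqxx mulr1 big1 ?addr0 // => l lj.
  by rewrite mxE crd_bas eq_sym (negPf lj) mulr0.
by rewrite -(E x) e E.
Qed.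

Lemma pure2_sum_bas_l (A B : vectType k) (x y : 'I_(\dim {:A}) -> B) :
  \sum_i pure2 (bas i) (x i) = \sum_i pure2 (bas i) (y i) -> x =1 y.
Proof.
move=> e i; rewrite [x i]crd_sum [y i]crd_sum; apply: eq_bigr => j _.
have E z : (\sum_i pure2 (bas i : A) (z i)) i j = crd j (z i : B).
  rewrite summxE (bigD1 i) //= mxE crd_bas eqxx mul1r big1 ?addr0 // => l lj.
  by rewrite mxE crd_bas eq_sym (negPf lj) mul0r.
by rewrite -(E x) e E.
Qed.

Definition ext_fun a b (g : 'I_a -> 'I_a) (g' : 'I_b -> 'I_b) (i : 'I_(a + b)) :=
  unsplit (match split i with inl x => inl (g x) | inr y => inr (g' y) end).

Lemma ext_lshift a b g g' i : @ext_fun a b g g' (lshift b i) = lshift b (g i).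
Proof. by rewrite /ext_fun -[lshift b i]/(unsplit (inl i)) unsplitK. Qed.

Lemma ext_rshift a b g g' i : @ext_fun a b g g' (rshift a i) = rshift a (g' i).
Proof. by rewrite /ext_fun -[rshift a i]/(unsplit (inr i)) unsplitK. Qed.

Lemma ext_inj a b (s : 'S_a) (s' : 'S_b) : injective (ext_fun s s').
Proof.
apply: (can_inj (g := ext_fun s^-1%g s'^-1%g)) => i; rewrite /ext_fun unsplitK.
by rewrite -[RHS]splitK; case: (split i) => x; rewrite permK.
Qed.

Lemma sym2_inclP a b (t : tens2 (tpow a V) (tpow b V)) :
  (forall (s : 'S_a), tens2_map (tpow_perm V s) \1%VF t = t) ->
  (forall (s : 'S_b), tens2_map \1%VF (tpow_perm V s) t = t) ->
  t \in limg (sym2_incl a b V).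
Proof.
have lv n : linear (@vsval _ _ (symv n V)) by move=> c x y; rewrite linearP.
move=> ta tb.
set tp := tens2_map (linfun (vsproj (symv a V))) (linfun (vsproj (symv b V))) t.
suff -> : t = sym2_incl a b V tp by rewrite memv_img ?memvf.
have lp n : linear (vsproj (symv n V)) by move=> c x y; rewrite linearP.
pose Pa := (linfun (@vsval _ _ (symv a V)) \o linfun (vsproj (symv a V)))%VF.
pose Pb := (linfun (@vsval _ _ (symv b V)) \o linfun (vsproj (symv b V)))%VF.
have PE n x : x \in symv n V ->
    (linfun (@vsval _ _ (symv n V)) \o linfun (vsproj (symv n V)))%VF x = x.
  by move=> xs; rewrite comp_lfunE (linfun_linear (lv n)) (linfun_linear (lp n)) vsprojK.
have -> : sym2_incl a b V tp = tens2_map Pa \1%VF (tens2_map \1%VF Pb t).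
  rewrite /tp -!comp_lfunE; apply: tens2_ext => x y.
  by rewrite !comp_lfunE /sym2_incl !tens2_map_pure !comp_lfunE !id_lfunE.
have -> : tens2_map \1%VF Pb t = t.
  rewrite tens2_map_coordl [RHS]pure2_coordl.
  apply: eq_bigr => i _; rewrite id_lfunE PE //; apply/symvP => s; move: i.
  apply: pure2_sum_bas_l; rewrite -[RHS]pure2_coordl -[RHS](tb s) tens2_map_coordl.
  by apply: eq_bigr => i _; rewrite id_lfunE.
rewrite tens2_map_coordr [LHS]pure2_coordr.
apply: eq_bigr => i _; rewrite id_lfunE PE //; apply/symvP => s; move: i.
apply: pure2_sum_bas_r; rewrite -[RHS]pure2_coordr -[RHS](ta s) tens2_map_coordr.
by apply: eq_bigr => i _; rewrite id_lfunE.
Qed.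

Lemma sym_splitP a b d (h : (a + b)%N = d) (t : symt d V) :
  sym2_incl a b V (sym_split h V t) = cut h V (vsval t).
Proof.
rewrite /sym_split linfun_linear => [|c x y]; last by rewrite !linearP.
have /memv_imgP[x _ ->] : cut h V (vsval t) \in limg (sym2_incl a b V); last first.
  by rewrite lker0_lfunK // lker_sym2_incl.
case: d / h t => t.
have ct (s : 'S_(a + b)) : cut erefl V (tpow_perm V s (vsval t)) = cut erefl V (vsval t).
  by rewrite (symvP _ (subvsP t)).
apply: sym2_inclP => s.
  rewrite -[RHS](ct (perm (ext_inj (s := s) (s' := 1%g)))) -!comp_lfunE.
  apply: tens_ext => v; rewrite !comp_lfunE tpow_perm_pure !cut_pure tens2_map_pure.
  rewrite tpow_perm_pure id_lfunE; congr pure2; apply: (pure_multilinear _).1 => i;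
    by rewrite permE !cast_ord_id ?ext_lshift ?ext_rshift ?perm1.
rewrite -[RHS](ct (perm (ext_inj (s := 1%g) (s' := s)))) -!comp_lfunE.
apply: tens_ext => v; rewrite !comp_lfunE tpow_perm_pure !cut_pure tens2_map_pure.
rewrite tpow_perm_pure id_lfunE; congr pure2; apply: (pure_multilinear _).1 => i;
  by rewrite permE !cast_ord_id ?ext_lshift ?ext_rshift ?perm1.
Qed.

Lemma sym_split_vpow a b d (h : (a + b)%N = d) (v : V) :
  sym_split h V (vpow d v) = pure2 (vpow a v) (vpow b v).
Proof.
have lv n : linear (@vsval _ _ (symv n V)) by move=> c x y; rewrite linearP.
apply: (lker0P (lker_sym2_incl a b)).
by rewrite sym_splitP vsval_vpow cut_pure tens2_map_pure (linfun_linear (lv a)) (linfun_linear (lv b)) !vsval_vpow.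
Qed.
End Split.

Section Mixed.
Variables (k : fieldType) (p : nat).
Implicit Types (d a b : 'I_p -> nat) (V W : 'I_p -> vectType k).

Lemma mixed_map_veronese d V W (h : forall i, 'Hom(V i, W i)) (u : forall i, V i) :
  mixed_map d h (veronese d u) = veronese d (fun i => h i (u i)).
Proof.
rewrite /mixed_map tens_map_pure; apply: (pure_multilinear _).1 => i; apply: val_inj.
by rewrite [LHS]vsval_sym_map /= !vsval_vpow tens_map_pure.
Qed.

Lemma flattening_veronese a b d (h : forall i, (a i + b i)%N = d i) V (u : forall i, V i)
    (phi : dual (mixed a V)) :
  flattening h (veronese d u) phi = (phi (veronese a u) : k) *: veronese b u.
Proof.
rewrite -contract_pure -regroup_pure /flattening tens_map_pure.
congr (contract _ _ (regroup _ _ _) _).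
by apply: (pure_multilinear _).1 => i; rewrite sym_split_vpow.
Qed.
End Mixed.

(* Main.v *)
(* A flattening of a tensor of rank r has rank at most r, so it suffices that some
   flattening of T1 + T2 has rank r1 + r2.  If some a_i and some b_i are positive,
   then V_A and W_A meet trivially in U_A, V_B and W_B meet trivially in U_B, and the
   image of the flattening of T1 + T2 contains the direct sum of the images of those of
   T1 and T2.  If all a_i or all b_i vanish, then r1, r2 <= 1, so that every
   flattening of T1 and T2 has rank r1 and r2; since the degrees add up to at
   least 2, one can move to a pair (A, B) of the first kind. *)
Require Import Defs.
From mathcomp Require Import all_boot all_order all_fingroup all_algebra.
Local Open Scope ring_scope.

Set Implicit Arguments.
Unset Strict Implicit.
Unset Printing Implicit Defensive.
Import GRing.Theory.

(** * Extensionality and functoriality of tensor products *)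

Section Tensors.
Variables (k : fieldType) (J : finType).
Implicit Types (V W Z : J -> vectType k) (X : vectType k).

Lemma multilinear_span_ext V X (M N : (forall j, V j) -> X)
    (S : forall j, V j -> Prop) :
  multilinear M -> multilinear N ->
  (forall j x, exists (I : finType) (c : I -> k) (y : I -> V j),
      (forall i, S j (y i)) /\ x = \sum_i c i *: y i) ->
  (forall v, (forall j, S j (v j)) -> M v = N v) ->
  forall v, M v = N v.
Proof.
move=> [Me Ml] [Ne Nl] spanS MN v.
(* Induction on the list of slots whose entry may still lie outside [S]; it starts with all slots,
   and each step expands the first one by multilinearity. *)
have: forall j, j \notin enum J -> S j (v j) by move=> j; rewrite mem_enum.
elim: (enum J) v => [|j s IH] v vS; first by apply: MN => j; exact: vS.
have [I [c [y [yS vj]]]] := spanS j (v j).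
have step P : multilinear P -> P v = \sum_i c i *: P (dfwith v (y i)).
  move=> [Pe Pl]; rewrite (Pe v (dfwith v (v j))); last by move=> i; case: dfwithP.
  by rewrite {1}vj (linear_combination _ _ (Pl v j)).
rewrite !step //; apply: eq_bigr => i _; congr (_ *: _); apply: IH => l ls.
case: dfwithP ls => [_ //|l' jl ls]; apply: vS.
by rewrite inE negb_or eq_sym jl.
Qed.

Lemma multilinear_hom V X (g : 'Hom(tens V, X)) : multilinear (fun v => g (pure v)).
Proof.
have [pe pl] := pure_multilinear V.
by split=> [v w /pe ->//|v j c x y]; rewrite pl linearP.
Qed.

(** If every [v j] is nonzero, choose a nonzero coordinate of each: their product is a nonzero
    coordinate of [pure v], as [k] has no zero divisors. *)
Lemma pure_eq0 V (v : forall j, V j) : (pure v == 0) = [exists j, v j == 0].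
Proof.
apply/eqP/idP => [pv0|/existsP[j /eqP vj0]]; last first.
  apply/ffunP => f; rewrite !ffunE (bigD1 j) //= vj0.
  by rewrite /crd linear0 mul0r.
apply: contraT; rewrite negb_exists => /forallP v0.
have crd_v j : {i : 'I_(\dim {:V j}) | crd i (v j) != 0}.
  apply: sigW; apply/existsP; rewrite -negb_forall; apply: contra (v0 j) => /forallP c0.
  by rewrite [v j]crd_sum big1 // => i _; rewrite (eqP (c0 i)) scale0r.
have /ffunP/(_ [ffun j => sval (crd_v j)]) := pv0.
rewrite !ffunE => /eqP; rewrite prodf_seq_eq0 => /hasP[j _ /=].
by rewrite ffunE (negPf (svalP (crd_v j))).
Qed.

Lemma tens_map_comp V W Z (g : forall j, 'Hom(W j, Z j)) (h : forall j, 'Hom(V j, W j)) t :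
  tens_map g (tens_map h t) = tens_map (fun j => (g j \o h j)%VF) t.
Proof.
rewrite -comp_lfunE; apply: tens_ext => v; rewrite comp_lfunE !tens_map_pure.
by apply: (pure_multilinear _).1 => j; rewrite comp_lfunE.
Qed.

Lemma tens_map_id V (h : forall j, 'Hom(V j, V j)) t :
  (forall j, h j =1 id) -> tens_map h t = t.
Proof.
move=> hid; rewrite -[RHS]id_lfunE; apply: tens_ext => v.
rewrite tens_map_pure id_lfunE; apply: (pure_multilinear _).1 => j; exact: hid.
Qed.

Lemma tens_map_eq0 V W (h : forall j, 'Hom(V j, W j)) j t :
  h j =1 (fun=> 0) -> tens_map h t = 0.
Proof.
move=> hj0; rewrite -[RHS](zero_lfunE (tens W) t); apply: tens_ext => v.
rewrite tens_map_pure zero_lfunE; apply/eqP; rewrite pure_eq0.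
by apply/existsP; exists j; rewrite hj0.
Qed.

(** The [pure2 a b] span each factor. This fits [regroup], whose value is explicit on products of
    such tensors. *)
Lemma tens_tens2_ext (A B : J -> vectType k) X
    (g h : 'Hom(tens (fun j => tens2 (A j) (B j)), X)) :
  (forall a b, g (pure (fun j => pure2 (a j) (b j))) =
               h (pure (fun j => pure2 (a j) (b j)))) ->
  g =1 h.
Proof.
move=> gh; apply: tens_ext.
apply: (multilinear_span_ext (S := fun j x => exists ab : A j * B j, x = pure2 ab.1 ab.2));
  try exact: multilinear_hom.
  move=> j x; exists ('I_(\dim {:A j}) * 'I_(\dim {:B j}))%type.
  exists (fun i => x i.1 i.2), (fun i => pure2 (bas i.1) (bas i.2)).
  split=> [i|]; first by exists (bas i.1, bas i.2).
  by rewrite {1}[x]tens2_basis pair_bigA.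
move=> v vS; have w j : {ab : A j * B j | v j == pure2 ab.1 ab.2}.
  by apply: sigW; have [ab ->] := vS j; exists ab.
rewrite ((multilinear_hom g).1 _ (fun j => pure2 (sval (w j)).1 (sval (w j)).2)).
  by rewrite gh; apply: (multilinear_hom h).1 => j; rewrite -(eqP (svalP (w j))).
by move=> j; rewrite -(eqP (svalP (w j))).
Qed.

Lemma regroup_natural (A B A' B' : J -> vectType k)
    (g : forall j, 'Hom(A j, A' j)) (h : forall j, 'Hom(B j, B' j)) t :
  regroup A' B' (tens_map (fun j => tens2_map (g j) (h j)) t) =
  tens2_map (tens_map g) (tens_map h) (regroup A B t).
Proof.
rewrite -!comp_lfunE; apply: tens_tens2_ext => a b.
rewrite !comp_lfunE regroup_pure tens_map_pure tens2_map_pure !tens_map_pure.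
rewrite -regroup_pure; congr (regroup _ _ _).
by apply: (pure_multilinear _).1 => j; rewrite tens2_map_pure.
Qed.
End Tensors.

Lemma contract_natural (k : fieldType) (A B A' B' : vectType k)
    (g : 'Hom(A, A')) (h : 'Hom(B, B')) t (phi : dual A') :
  contract A' B' (tens2_map g h t) phi = h (contract A B t (phi \o g)%VF).
Proof.
rewrite [t]tens2_basis !linear_sum !sum_lfunE linear_sum; apply: eq_bigr => i _.
rewrite !linear_sum !sum_lfunE linear_sum; apply: eq_bigr => j _.
rewrite !linearZ /= !scale_lfunE linearZ; congr (_ *: _).
by rewrite tens2_map_pure !contract_pure linearZ /= comp_lfunE.
Qed.

(** * Functoriality of symmetric powers *)

Section Symmetric.
Variable k : fieldType.
Implicit Types V U Z : vectType k.

Lemma sym_map_comp d V U Z (g : 'Hom(U, Z)) (h : 'Hom(V, U)) t :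
  sym_map d g (sym_map d h t) = sym_map d (g \o h)%VF t.
Proof. by apply: val_inj; rewrite [LHS]vsval_sym_map [RHS]vsval_sym_map vsval_sym_map tens_map_comp. Qed.

Lemma sym_map_id d V (h : 'Hom(V, V)) t : h =1 id -> sym_map d h t = t.
Proof. by move=> hid; apply: val_inj; rewrite [LHS]vsval_sym_map tens_map_id. Qed.

(** A positive degree provides a slot in which to apply [h]; in degree 0 the induced map is an
    isomorphism of lines, whatever [h] is. *)
Lemma sym_map_eq0 d V U (h : 'Hom(V, U)) t :
  (0 < d)%N -> h =1 (fun=> 0) -> sym_map d h t = 0.
Proof.
move=> d_gt0 h0; apply: val_inj; rewrite [LHS]vsval_sym_map.
by rewrite (tens_map_eq0 (j := Ordinal d_gt0)).
Qed.

Lemma vpow_eq0 d V (v : V) : (vpow d v == 0) = (0 < d)%N && (v == 0).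
Proof.
rewrite -(inj_eq val_inj) /= vsval_vpow pure_eq0.
by apply/existsP/andP => [[[i /(leq_ltn_trans (leq0n i)) ->] ->]|[d_gt0 v0]] //;
  exists (Ordinal d_gt0).
Qed.

Lemma vpow0 V (v w : V) : vpow 0 v = vpow 0 w.
Proof. by apply: val_inj; rewrite /= !vsval_vpow; apply: (pure_multilinear _).1 => -[]. Qed.

(** Since [sym2_incl] is injective, it suffices to compare inside the full tensor powers, where the
    claim becomes naturality of [cut]. *)
Lemma sym_split_natural a b d (h : (a + b)%N = d) V U (g : 'Hom(V, U)) t :
  sym_split h U (sym_map d g t) =
  tens2_map (sym_map a g) (sym_map b g) (sym_split h V t).
Proof.
have lv n X : linear (@vsval k _ (symv n X)) by move=> c x y; rewrite linearP.
apply: (lker0P (lker_sym2_incl U a b)); rewrite sym_splitP vsval_sym_map.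
transitivity (tens2_map (tens_map (fun _ : 'I_a => g)) (tens_map (fun _ : 'I_b => g))
                (cut h V (vsval t))).
  rewrite -!comp_lfunE; apply: tens_ext => v.
  by rewrite !comp_lfunE tens_map_pure !cut_pure tens2_map_pure !tens_map_pure.
rewrite -sym_splitP; move: (sym_split h V t) => {}t.
rewrite -!comp_lfunE; apply: tens2_ext => x y.
rewrite !comp_lfunE /sym2_incl !tens2_map_pure.
by rewrite !(linfun_linear (lv _ _)) !vsval_sym_map.
Qed.
End Symmetric.

(** * Mixed tensors and their rank *)

Section Mixed.
Variables (k : fieldType) (p : nat).
Implicit Types (d a b : 'I_p -> nat) (U V W Z : 'I_p -> vectType k).

Lemma mixed_mapK d V W (g : forall i, 'Hom(W i, V i)) (h : forall i, 'Hom(V i, W i)) :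
  (forall i, cancel (h i) (g i)) -> cancel (mixed_map d h) (mixed_map d g).
Proof.
move=> hK t; rewrite /mixed_map tens_map_comp tens_map_id // => i x.
by rewrite comp_lfunE sym_map_comp sym_map_id // => v; rewrite comp_lfunE hK.
Qed.

(** A single vanishing factor of positive degree kills the whole tensor product. Applied to the
    projection onto one summand after the inclusion of the other, this makes the two summands
    independent. *)
Lemma mixed_map_comp_eq0 d V W Z (g : forall i, 'Hom(W i, Z i))
    (h : forall i, 'Hom(V i, W i)) i t :
  (0 < d i)%N -> (forall x, g i (h i x) = 0) -> mixed_map d g (mixed_map d h t) = 0.
Proof.
move=> d_gt0 gh0; rewrite /mixed_map tens_map_comp (tens_map_eq0 (j := i)) // => x.
by rewrite comp_lfunE sym_map_comp sym_map_eq0 // => v; rewrite comp_lfunE gh0.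
Qed.

Lemma veronese_eq0 d V (u : forall i, V i) :
  (veronese d u == 0) = [exists i, (0 < d i)%N && (u i == 0)].
Proof. by rewrite pure_eq0; apply: eq_existsb => i; rewrite vpow_eq0. Qed.

Lemma veronese0 d V (u w : forall i, V i) :
  (forall i, d i = 0%N) -> veronese d u = veronese d w.
Proof.
move=> d0; apply: (pure_multilinear _).1 => i; rewrite d0; exact: vpow0.
Qed.

Lemma rank_leD d V (T1 T2 : mixed d V) r1 r2 :
  rank_le T1 r1 -> rank_le T2 r2 -> rank_le (T1 + T2) (r1 + r2).
Proof.
move=> [c1 [u1 ->]] [c2 [u2 ->]].
exists (fun l => match split l with inl i => c1 i | inr i => c2 i end).
exists (fun l => match split l with inl i => u1 i | inr i => u2 i end).
rewrite big_split_ord /=; congr (_ + _); apply: eq_bigr => i _.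
  by rewrite -[lshift _ _]/(unsplit (inl i)) unsplitK.
by rewrite -[rshift _ _]/(unsplit (inr i)) unsplitK.
Qed.

Lemma rank_le_mixed_map d V W (h : forall i, 'Hom(V i, W i)) (T : mixed d V) r :
  rank_le T r -> rank_le (mixed_map d h T) r.
Proof.
move=> [c [u ->]]; exists c, (fun l i => h i (u l i)).
rewrite linear_sum; apply: eq_bigr => l _.
by rewrite linearZ /= mixed_map_veronese.
Qed.

(** * Naturality and ranks of flattenings *)

Section Flattening.
Variables (a b d : 'I_p -> nat) (h : forall i, (a i + b i)%N = d i).

Lemma flattening_linear V : linear (flattening h (V := V)).
Proof. by move=> c x y; rewrite /flattening !linearP. Qed.

Lemma flattening_natural V W (g : forall i, 'Hom(V i, W i)) (T : mixed d V)
    (phi : dual (mixed a W)) :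
  flattening h (mixed_map d g T) phi =
  mixed_map b g (flattening h T (phi \o mixed_map a g)%VF).
Proof.
rewrite /flattening -contract_natural -regroup_natural; congr (contract _ _ (regroup _ _ _) _).
rewrite /mixed_map -!comp_lfunE; apply: tens_ext => v.
rewrite !comp_lfunE !tens_map_pure.
by apply: (pure_multilinear _).1 => i; rewrite sym_split_natural.
Qed.

Lemma flattening_sum V r (c : 'I_r -> k) (u : 'I_r -> forall i, V i) phi :
  flattening h (\sum_(l < r) c l *: veronese d (u l)) phi =
  \sum_(l < r) (c l * phi (veronese a (u l))) *: veronese b (u l).
Proof.
rewrite (linear_combination _ _ (@flattening_linear V)) sum_lfunE.
by apply: eq_bigr => l _; rewrite scale_lfunE flattening_veronese scalerA.
Qed.

(** The image is spanned by the [r] vectors [veronese b (u l)]. *)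
Lemma dim_flattening_le V (T : mixed d V) r :
  rank_le T r -> (\dim (limg (flattening h T)) <= r)%N.
Proof.
move=> [c [u ->]].
pose s := mktuple (fun l => veronese b (u l)); rewrite -[leqRHS](size_tuple s).
apply: leq_trans (dim_span _); apply: dimvS; apply/subvP => _ /memv_imgP[phi _ ->].
rewrite flattening_sum; apply: memv_suml => l _; apply/memvZ/memv_span.
by apply/tnthP; exists l; rewrite tnth_mktuple.
Qed.

Lemma dim_flattening_degenerate V (T : mixed d V) r :
  rank_le T r -> (forall i, a i = 0%N) \/ (forall i, b i = 0%N) ->
  (\dim (limg (flattening h T)) <= 1)%N.
Proof.
move=> [c [u ->]] ab0.
suff [x limgx] : exists x, (limg (flattening h (\sum_(l < r) c l *: veronese d (u l)))
                            <= <[x]>)%VS.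
  by apply: leq_trans (dimvS limgx) _; rewrite dim_vline; case: (x != 0).
case: ab0 => [a0|b0].
  exists (\sum_(l < r) c l *: veronese b (u l)); apply/subvP => _ /memv_imgP[phi _ ->].
  (* In multidegree zero [veronese a] does not depend on its argument, so the zero family serves as
     a representative and the common scalar factors out of the sum. *)
  rewrite flattening_sum; apply/vlineP; exists (phi (veronese a (fun i => 0))).
  rewrite scaler_sumr; apply: eq_bigr => l _.
  by rewrite (veronese0 _ (fun i => 0) a0) scalerA mulrC.
exists (veronese b (fun i => 0)); apply/subvP => _ /memv_imgP[phi _ ->].
rewrite flattening_sum; apply: memv_suml => l _.
by rewrite (veronese0 _ (fun i => 0) b0) memvZ ?memv_line.
Qed.

(** A tensor of rank 1 is a nonzero multiple of some [veronese d u], and its flattening sends [phi]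
    to a multiple of [phi (veronese a u)] times [veronese b u]; both Veronese vectors are nonzero
    for any [a], [b]. *)
Lemma dim_flattening_rank_le1 V (T : mixed d V) r :
  (forall i, (0 < d i)%N) -> has_rank T r -> (r <= 1)%N ->
  \dim (limg (flattening h T)) = r.
Proof.
move=> d_gt0 [Tr Tmin] r_le1; apply/eqP; rewrite eqn_leq dim_flattening_le //=.
case: r r_le1 Tr Tmin => [//|[|//]] _ [c [u]]; rewrite big_ord1 => TE Tmin.
have T_neq0 : T != 0.
  apply/negP => /eqP T0; have /Tmin // : rank_le T 0.
  by exists (fun=> 0), (fun _ _ => 0); rewrite big_ord0.
move: T_neq0; rewrite TE scaler_eq0 negb_or => /andP[c0].
rewrite veronese_eq0 negb_exists => /forallP u0.
(* As all [d i] are positive, every component of [u ord0] is nonzero, which gives nonvanishing in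
   every multidegree [e]. *)
have ver_neq0 e : veronese e (u ord0) != 0.
  rewrite veronese_eq0 negb_exists; apply/forallP => i.
  by move: (u0 i); rewrite d_gt0 /= => /negPf->; rewrite andbF.
have [i crd_i] : exists i, crd i (veronese a (u ord0)) != 0.
  apply/existsP; rewrite -negb_forall; apply: contra (ver_neq0 a) => /forallP crd0.
  by rewrite [veronese _ _]crd_sum big1 // => i _; rewrite (eqP (crd0 i)) scale0r.
pose phi : dual (mixed a V) := linfun (crd i : _ -> k^o).
rewrite lt0n dimv_eq0; apply: contraNneq (ver_neq0 b) => limg0.
have : flattening h (c ord0 *: veronese d (u ord0)) phi \in 0%VS.
  by rewrite -limg0 memv_img ?memvf.
have -> : c ord0 *: veronese d (u ord0) = \sum_(l < 1) c l *: veronese d (u l).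
  by rewrite big_ord1.
rewrite flattening_sum big_ord1 memv0 !scaler_eq0 mulf_eq0 (negPf c0) /=.
by rewrite (linfun_linear (crd_linear i)) (negPf crd_i).
Qed.

(** Functionals pulled back along [pV] or [pW] isolate one tensor: slot [i], with [a i] positive,
    annihilates the other. Slot [j], with [b j] positive, makes the two images independent. *)
Lemma limg_flattening_dsum U V W
    (iV : forall i, 'Hom(V i, U i)) (iW : forall i, 'Hom(W i, U i))
    (pV : forall i, 'Hom(U i, V i)) (pW : forall i, 'Hom(U i, W i)) T1 T2 i j :
  (forall i, cancel (iV i) (pV i)) -> (forall i, cancel (iW i) (pW i)) ->
  (forall i x, pV i (iW i x) = 0) -> (forall i x, pW i (iV i x) = 0) ->
  (0 < a i)%N -> (0 < b j)%N ->
  (\dim (limg (flattening h T1)) + \dim (limg (flattening h T2)) <=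
   \dim (limg (flattening h (mixed_map d iV T1 + mixed_map d iW T2))))%N.
Proof.
move=> iVK iWK pViW pWiV a_gt0 b_gt0.
have kV : lker (mixed_map b iV) == 0%VS by apply/lker0P/can_inj/mixed_mapK.
have kW : lker (mixed_map b iW) == 0%VS by apply/lker0P/can_inj/mixed_mapK.
have flatE phi : flattening h (mixed_map d iV T1 + mixed_map d iW T2) phi =
    mixed_map b iV (flattening h T1 (phi \o mixed_map a iV)%VF) +
    mixed_map b iW (flattening h T2 (phi \o mixed_map a iW)%VF).
  by rewrite -!flattening_natural /flattening !linearD add_lfunE.
rewrite -(limg_dim_eq (f := mixed_map b iV)); last by rewrite (eqP kV) capv0.
rewrite -(limg_dim_eq (U := limg (flattening h T2)) (f := mixed_map b iW)); last first.
  by rewrite (eqP kW) capv0.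
(* A common vector is recovered by [mixed_map b pV] from its [V] form and killed by it in its [W]
   form. *)
rewrite -dimv_disjoint_sum; last first.
  apply/eqP; rewrite -subv0; apply/subvP => x; rewrite memv_cap memv0.
  case/andP=> /memv_imgP[y _ ->] /memv_imgP[z _ yz]; apply/eqP.
  have y0 : y = 0.
    rewrite -[y](mixed_mapK iVK) yz; exact: mixed_map_comp_eq0 b_gt0 (pViW j).
  by rewrite y0 linear0.
apply: dimvS; rewrite subv_add; apply/andP.
split; apply/subvP => _ /memv_imgP[_ /memv_imgP[phi _ ->] ->].
  have -> : mixed_map b iV (flattening h T1 phi) =
      flattening h (mixed_map d iV T1 + mixed_map d iW T2) (phi \o mixed_map a pV)%VF.
    rewrite flatE; have -> : (phi \o mixed_map a pV \o mixed_map a iV)%VF = phi.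
      by apply/lfunP => x; rewrite !comp_lfunE mixed_mapK.
    have -> : (phi \o mixed_map a pV \o mixed_map a iW)%VF = 0.
      apply/lfunP => x; rewrite !comp_lfunE zero_lfunE.
      by rewrite (mixed_map_comp_eq0 _ a_gt0 (pViW i)) linear0.
    by rewrite !linear0 addr0.
  by rewrite memv_img ?memvf.
have -> : mixed_map b iW (flattening h T2 phi) =
    flattening h (mixed_map d iV T1 + mixed_map d iW T2) (phi \o mixed_map a pW)%VF.
  rewrite flatE; have -> : (phi \o mixed_map a pW \o mixed_map a iW)%VF = phi.
    by apply/lfunP => x; rewrite !comp_lfunE mixed_mapK.
  have -> : (phi \o mixed_map a pW \o mixed_map a iV)%VF = 0.
    apply/lfunP => x; rewrite !comp_lfunE zero_lfunE.
    by rewrite (mixed_map_comp_eq0 _ a_gt0 (pWiV i)) linear0.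
  by rewrite !linear0 add0r.
by rewrite memv_img ?memvf.
Qed.
End Flattening.
End Mixed.

Unset Implicit Arguments.

Theorem proposition3p3 (k : fieldType) (p : nat)
    (V W : 'I_p -> vectType k) (n m d : 'I_p -> nat)
    (dimV : forall i, \dim {:V i} = (n i).+1)
    (dimW : forall i, \dim {:W i} = (m i).+1)
    (d_gt0 : forall i, (0 < d i)%N)
    (d_gt1 : (1 < \sum_(i < p) d i)%N)
    (T1 : mixed d V) (T2 : mixed d W) (r1 r2 : nat)
    (rkT1 : has_rank T1 r1) (rkT2 : has_rank T2 r2)
    (hflat : exists (a b : 'I_p -> nat) (h : forall i, (a i + b i)%N = d i),
        \dim (limg (flattening h T1)) = r1 /\
        \dim (limg (flattening h T2)) = r2) :
  has_rank (mixed_map d (fun i => dinl (V i) (W i)) T1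
            + mixed_map d (fun i => dinr (V i) (W i)) T2) (r1 + r2)%N.
Proof.
split; first by apply: rank_leD; apply: rank_le_mixed_map; [case: rkT1 | case: rkT2].
(* The upper bound is done. The lower bound follows from one bidegree, shared by both tensors, in
   which neither [a] nor [b] is identically zero. *)
suff [a [b [h [[i a_gt0] [j b_gt0] <- <-]]]] :
    exists (a b : 'I_p -> nat) (h : forall i, (a i + b i)%N = d i),
      [/\ exists i, (0 < a i)%N, exists i, (0 < b i)%N,
          \dim (limg (flattening h T1)) = r1 & \dim (limg (flattening h T2)) = r2].
  move=> s /(dim_flattening_le h); apply: leq_trans.
  have inlE i' x : dinl (V i') (W i') x = (x, 0).
    by apply: linfun_linear => c y z; congr (_, _); rewrite /= scaler0 addr0.
  have inrE i' x : dinr (V i') (W i') x = (0, x).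
    by apply: linfun_linear => c y z; congr (_, _); rewrite /= scaler0 addr0.
  have fstE i' x : linfun (fun x : dsum (V i') (W i') => x.1) x = x.1.
    exact: (@linfun_linear _ _ _ (fun x : dsum (V i') (W i') => x.1)).
  have sndE i' x : linfun (fun x : dsum (V i') (W i') => x.2) x = x.2.
    exact: (@linfun_linear _ _ _ (fun x : dsum (V i') (W i') => x.2)).
  by apply: (limg_flattening_dsum h (pV := fun i => linfun (fun x : dsum (V i) (W i) => x.1))
    (pW := fun i => linfun (fun x : dsum (V i) (W i) => x.2)) _ _ _ _ _ _ a_gt0 b_gt0) => i' x;
    rewrite ?inlE ?inrE ?fstE ?sndE.
have [a [b [h [dim1 dim2]]]] := hflat.
have pos_or0 (e : 'I_p -> nat) : (exists i, (0 < e i)%N) \/ (forall i, e i = 0%N).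
  have [/existsP|] := boolP [exists i, (0 < e i)%N]; first by left.
  by rewrite negb_exists => /forallP e0; right=> i; apply/eqP; rewrite -leqn0 leqNgt.
suff [//|degenerate] : ((exists i, (0 < a i)%N) /\ (exists i, (0 < b i)%N)) \/
    ((r1 <= 1)%N /\ (r2 <= 1)%N).
- by case=> *; exists a, b, h.
- case: degenerate => r1_le1 r2_le1.
  (* With ranks at most 1 every bidegree computes them, so a new one may be chosen: [a'] takes
     degree 1 from a single index [i0]. *)
  have [i0 _|p0] := pickP (@predT 'I_p); last by rewrite big_pred0 // in d_gt1.
  pose a' i := nat_of_bool (i == i0); pose b' i := (d i - a' i)%N.
  have h' i : (a' i + b' i)%N = d i.
    by rewrite subnKC //; apply: leq_trans (leq_b1 _) (d_gt0 i).
  exists a', b', h'; split; try exact: dim_flattening_rank_le1.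
    by exists i0; rewrite /a' eqxx.
  (* If [b'] vanished, the degrees would sum to 1, contradicting [d_gt1]. *)
  case: (pos_or0 b') => // b'0; move: d_gt1.
  under eq_bigr do rewrite -h' b'0 addn0.
  by rewrite (bigD1 i0) //= /a' eqxx big1 // => i /negPf->.
have [[rk1 _] [rk2 _]] := (rkT1, rkT2).
case: (pos_or0 a) (pos_or0 b) => [a_pos|a0] [b_pos|b0]; first by left.
all: by right; rewrite -dim1 -dim2; split;
  [apply: dim_flattening_degenerate rk1 _ | apply: dim_flattening_degenerate rk2 _]; auto.
Qed.
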